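(* Let $d>0$ be an integer with $-d\equiv 2,3\pmod 4$, let $M=\mathbb{Q}(i\sqrt{d})$ with ring of integers $\mathbb{Z}_M$, let $t\in\mathbb{Z}_M$, let $\xi$ be a root of the polynomial $$f(x)=x^4-4tx^3+(6t+2)x^2+4tx+1,$$ and let $\mathcal{O}=\mathbb{Z}_M[\xi]$. If $|t|>1544803$, then the order $\mathcal{O}$ admits no power integral bases.
   Context: $\mathcal{O}$ is regarded as an order of the octic field $K=M(\xi)$. The order $\mathcal{O}$ admits a power integral basis if there exists $\alpha\in\mathcal{O}$ with $\mathcal{O}=\mathbb{Z}[\alpha]$. $|t|$ is the complex absolute value. *)

(* Defs.v *)
(* Number fields are taken inside algC, the field of algebraic
   complex numbers, whose norm `|.| is the complex absolute value. *)
From mathcomp Require Import all_boot all_order all_algebra all_field.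
From mathcomp Require Import classical_sets.
Set Implicit Arguments.
Unset Strict Implicit.
Unset Printing Implicit Defensive.
Import Order.TTheory GRing.Theory Num.Theory.
Local Open Scope classical_set_scope.
Local Open Scope ring_scope.

(* A[x], for A a subring of algC. *)
Definition ring_adjoin (A : set algC) (x : algC) : set algC :=
  [set z | exists2 p : {poly algC}, forall i, A p`_i & z = p.[x]].

(* Q(x). A vanishing denominator v is harmless: then u / v = 0. *)
Definition rat_adjoin (x : algC) : set algC :=
  [set z | exists u v, [/\ ring_adjoin [set` Crat] x u,
                           ring_adjoin [set` Crat] x v & z = u / v]].

Definition ring_of_integers (M : set algC) : set algC := M `&` [set` Aint].

Definition imquad (d : int) : set algC := rat_adjoin ('i * sqrtC d%:~R).

Definition quartic (t : algC) : {poly algC} :=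
  'X^4 - (4 * t) *: 'X^3 + (6 * t + 2) *: 'X^2 + (4 * t) *: 'X + 1.

Definition has_power_integral_basis (O : set algC) : Prop :=
  exists2 alpha, O alpha & O = ring_adjoin [set` Num.int] alpha.

(* Main.v *)
Require Import Defs.
From mathcomp Require Import all_boot all_order all_algebra all_field.
From mathcomp Require Import classical_sets.
From HB Require Import structures.
From mathcomp Require Import ring zify.
Set Implicit Arguments.
Unset Strict Implicit.
Unset Printing Implicit Defensive.
Import Order.TTheory GRing.Theory Num.Theory.
Local Open Scope ring_scope.

(** The obstruction to monogenicity sits at the prime 2.  Write R for the ring
    of integers of M = Q(i sqrt d), w = i sqrt d and f for the quartic.  The
    congruence on d makes 2 ramify in R: with eps equal to w or w + 1, the
    ideal P = (2, eps) satisfies P^2 <= 2R and R / P = F_2.  On the other hand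
    f = (X + 1)^4 mod 2.  Hence, as soon as f is irreducible over M, so that
    R[xi] = R[X] / (f), one gets
      R[xi] / 2 = F_2[e, y] / (e^2, y^4)    (y = xi + 1),
    a local ring whose cotangent space has dimension 2, whereas a quotient of
    F_2[X] has cotangent spaces of dimension at most 1.  So no single element
    generates R[xi] over Z.

    This argument is run without quotient rings.  A polynomial over R that
    vanishes at xi is a multiple of f (order_kernel_quartic), so its value at
    -1 lies in 2R and its derivative at -1 lies in P; therefore value and
    derivative at -1, the coordinates of the cotangent space, make sense on
    R[xi].  If alpha = A(xi) generated R[xi] over Z, then eps = p(alpha) and
    xi = r(alpha) with p, r over Z, and the chain rule applied to p o A and to
    r o A gives a contradiction (not_monogenic_of_cotangent).

    The size of t is used for irreducibility only.  The roots of f generate a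
    biquadratic extension of M unless one of 4t^2 - 6t - 4, 4t^2 + 2t and
    4t^2 - 8t is a square in M (quartic_basis).  Completing the square turns
    each of these into an equation u^2 - v^2 = n in R with n = 25, 1 or 4,
    and since nonzero elements of R have absolute value at least 1, both
    factors u - v and u + v are at most n in absolute value, which bounds t
    (imquad_sqr_diff_bound). *)

(** * Polynomials over a subring *)

Lemma polyOver_ind (C : nzRingType) (R : subringClosed C) (K : {poly C} -> Prop) :
  K 0 ->
  (forall p c, p \is a polyOver R -> c \in R -> K p -> K (p * 'X + c%:P)) ->
  forall p, p \is a polyOver R -> K p.
Proof.
move=> K0 KS; elim/poly_ind => // p c IHp pRc.
have coefR i : (p * 'X + c%:P)`_i \in R by apply/polyOverP.
have cR : c \in R by have := coefR 0; rewrite coefD coefMX coefC add0r.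
have pR : p \is a polyOver R.
  by apply/polyOverP=> i; have := coefR i.+1; rewrite coefD coefMX coefC addr0.
by apply: KS => //; apply: IHp.
Qed.

(** For h in the prime above 2 the last term vanishes modulo 2, so modulo 2 a
    polynomial acts near a through its value and derivative only. *)
Lemma taylor2_over (C : comNzRingType) (R : subringClosed C) (p : {poly C}) (a h : C) :
  p \is a polyOver R -> a \in R -> h \in R ->
  exists2 k, k \in R & p.[a + h] = p.[a] + p^`().[a] * h + k * h ^+ 2.
Proof.
move=> pR aR hR; elim/(polyOver_ind (R := R)): p / pR => [|p c pR cR [k kR Ek]].
  by exists 0; rewrite ?rpred0 // deriv0 !horner0; ring.
exists (p^`().[a] + k * (a + h)).
  by rewrite rpredD ?rpredM ?rpredD ?rpred_horner ?polyOver_deriv.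
by rewrite derivMXaddC !(hornerD, hornerM, hornerX, hornerC) Ek; ring.
Qed.

(** When f is irreducible over the fraction field, this puts the cofactor of f
    in a polynomial vanishing at a root of f back into R[X], and not merely
    into polynomials over the field.  Each division step only uses coefficients
    already in R because f is monic. *)
Lemma division_over (C : comNzRingType) (R : subringClosed C) (f p : {poly C}) :
  f \is monic -> f \is a polyOver R -> (1 < size f)%N -> p \is a polyOver R ->
  exists q r, [/\ q \is a polyOver R, r \is a polyOver R,
                  (size r < size f)%N & p = f * q + r].
Proof.
move=> fm fR f1 pR; elim/(polyOver_ind (R := R)): p / pR => [|p c pR cR [q [r [qR rR sr Ep]]]].
  by exists 0, 0; rewrite !rpred0 size_poly0 (ltnW f1) mulr0 addr0.
pose n := (size f).-1; have szf : size f = n.+1 by rewrite prednK // (ltnW f1).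
pose l := r`_n.-1; have lR : l \in R by apply/polyOverP.
exists (q * 'X + l%:P), (r * 'X + c%:P - l *: f).
have n0 : (0 < n)%N by rewrite -ltnS -szf.
split.
- by rewrite rpredD ?rpredM ?polyOverX ?polyOverC.
- by rewrite rpredB ?rpredD ?rpredM ?polyOverX ?polyOverC ?polyOverZ.
- rewrite szf ltnS; apply/leq_sizeP => j lenj.
  rewrite coefB coefD coefMX coefC coefZ.
  rewrite (gtn_eqF (leq_trans n0 lenj)) addr0; have [<-|nej] := eqVneq n j.
    have -> : f`_n = 1 by move/monicP: fm; rewrite lead_coefE.
    by rewrite mulr1 subrr.
  rewrite (nth_default 0 (s := f)) ?nth_default ?mulr0 ?subr0 // ?szf.
    by rewrite szf ltnS in sr; apply: leq_trans sr _; move: n0 lenj nej; clear; lia.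
  by rewrite ltn_neqAle nej.
- by rewrite Ep -mul_polyC; ring.
Qed.

(** * The cotangent obstruction at 2 *)

Lemma int_parity (n : int) : exists k, n = 2 * k \/ n = 2 * k + 1.
Proof. by exists (n %/ 2)%Z; lia. Qed.

Definition prime_over2 (R : {pred algC}) (eps : algC) : set algC :=
  [set z | exists u v, [/\ u \in R, v \in R & z = 2 * u + eps * v]]%classic.

Lemma prime_over2_sqr (R : subringClosed algC) eps z :
  eps \in R -> (exists2 w, w \in R & eps ^+ 2 = 2 * w) -> prime_over2 R eps z ->
  exists2 w, w \in R & z ^+ 2 = 2 * w.
Proof.
move=> eR [w wR Ew] [u [v [uR vR ->]]].
exists (2 * u ^+ 2 + 2 * u * eps * v + w * v ^+ 2).
  by rewrite !rpredD ?rpredM ?rpredX ?rpred_nat.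
have -> : (2 * u + eps * v) ^+ 2 =
  2 * (2 * u ^+ 2 + 2 * u * eps * v) + eps ^+ 2 * v ^+ 2 by ring.
by rewrite Ew; ring.
Qed.

(** Put u = A(c) and v = A'(c).  Since xi = r(A(xi)), the chain rule gives
    r'(u) v = 1 mod (2, eps), so v is not in the prime (2, eps); since
    eps = p(A(xi)) has derivative 0, p'(u) v is in it, hence so is p'(u).
    Modulo that prime u is an integer a, and then p(u) = p(a) mod 2R because
    both p'(a) and (u - a)^2 vanish modulo 2.  Thus eps would be congruent
    modulo 2R to the integer p(a). *)
Lemma not_monogenic_of_cotangent (R : subringClosed algC) (eps xi c : algC) :
  eps \in R -> c \in R ->
  (exists2 w, w \in R & eps ^+ 2 = 2 * w) ->
  (forall x, x \in R -> exists2 a, a \in Num.int & prime_over2 R eps (x - a)) ->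
  (forall a w, a \in Num.int -> w \in R -> eps <> a + 2 * w) ->
  ~ prime_over2 R eps 1 ->
  (forall P, P \is a polyOver R -> P.[xi] = 0 ->
     (exists2 w, w \in R & P.[c] = 2 * w) /\ prime_over2 R eps P^`().[c]) ->
  forall A p r, A \is a polyOver R ->
    p \is a polyOver Num.int -> r \is a polyOver Num.int ->
    eps = p.[A.[xi]] -> xi <> r.[A.[xi]].
Proof.
move=> eR cR eps2 residue eps_not_int not1 ker A p r AR pZ rZ Ep Er.
have intR x : x \in Num.int -> x \in R by move=> /intrP[m ->]; rewrite rpred_int.
have polyintR q : q \is a polyOver Num.int -> q \is a polyOver R.
  by apply: polyOverS.
have pR := polyintR p pZ; have rR := polyintR r rZ.
have PD x y : prime_over2 R eps x -> prime_over2 R eps y -> prime_over2 R eps (x + y).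
  move=> [u [v [uR vR ->]]] [u' [v' [uR' vR' ->]]].
  by exists (u + u'), (v + v'); split; rewrite ?rpredD //; ring.
have PM x y : prime_over2 R eps x -> y \in R -> prime_over2 R eps (x * y).
  move=> [u [v [uR vR ->]]] yR.
  by exists (u * y), (v * y); split; rewrite ?rpredM //; ring.
have P2 x : x \in R -> prime_over2 R eps (2 * x).
  by move=> xR; exists x, 0; split; rewrite ?rpred0 //; ring.
pose u := A.[c]; pose v := A^`().[c].
have uR : u \in R by rewrite rpred_horner.
have vR : v \in R by rewrite rpred_horner ?polyOver_deriv.
have compR q : q \is a polyOver R -> q \Po A \is a polyOver R.
  by move=> qR; rewrite polyOver_comp.
have [[w wR Ew] Pp] : (exists2 w, w \in R & p.[u] - eps = 2 * w) /\
    prime_over2 R eps (p^`().[u] * v).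
  have := ker (p \Po A - eps%:P).
  rewrite derivB derivC subr0 deriv_comp !hornerE !horner_comp -Ep subrr -/u -/v.
  by apply; rewrite // rpredB ?compR ?polyOverC.
have [_ Pr] : (exists2 w, w \in R & r.[u] - c = 2 * w) /\
    prime_over2 R eps (r^`().[u] * v - 1).
  have := ker (r \Po A - 'X).
  rewrite derivB derivX deriv_comp !hornerE !horner_comp -Er subrr -/u -/v.
  by apply; rewrite // rpredB ?compR ?polyOverX.
have [a aZ Ph] := residue _ uR.
set h := u - a in Ph; have Eu : u = a + h by rewrite /h; ring.
have hR : h \in R by rewrite /h; apply: rpredB => //; apply: intR.
have [h2 h2R Eh2] : exists2 h2, h2 \in R & h ^+ 2 = 2 * h2.
  exact: prime_over2_sqr eR eps2 Ph.
have [k kR Ek] := taylor2_over pR (intR _ aZ) hR.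
have dpR : p^`() \is a polyOver R by rewrite polyOver_deriv.
have [k' kR' Ek'] := taylor2_over dpR (intR _ aZ) hR.
have /intrP[m Em] : p^`().[a] \in Num.int by rewrite rpred_horner ?polyOver_deriv.
have ddR : p^`()^`().[a] \in R by rewrite rpred_horner ?polyOver_deriv ?intR.
(* p'(a) v is in the prime because p'(u) v and u - a are. *)
have Pmv : prime_over2 R eps (m%:~R * v).
  have -> : m%:~R * v = p^`().[u] * v + h * ((- p^`()^`().[a] - k' * h) * v).
    by rewrite Eu Ek' Em; ring.
  by apply: PD => //; apply: PM => //; rewrite rpredM // rpredB ?rpredN ?rpredM.
have [j [Ej|Ej]] := int_parity m.
- apply: (eps_not_int p.[a] (j%:~R * h + k * h2 - w)).
  + by rewrite rpred_horner.
  + by rewrite rpredB ?rpredD ?rpredM ?rpred_int.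
  + have -> : eps = p.[u] - 2 * w by rewrite -Ew; ring.
    by rewrite Eu Ek Em Eh2 Ej rmorphM /=; ring.
- have Pv : prime_over2 R eps v.
    have -> : v = m%:~R * v + 2 * (- j%:~R * v) by rewrite Ej rmorphD rmorphM /=; ring.
    by apply: PD => //; apply: P2; rewrite rpredM ?rpredN ?rpred_int.
  apply: not1.
  have -> : 1 = v * r^`().[u] + (r^`().[u] * v - 1) * -1 by ring.
  apply: PD; apply: PM; rewrite ?rpredN ?rpred1 //.
  by rewrite rpred_horner ?polyOver_deriv.
Qed.

(** * Irreducibility of the quartic *)

Lemma quarticE t :
  quartic t = Poly [:: 1; 4 * t; 6 * t + 2; - (4 * t); 1].
Proof.
rewrite /quartic /= !cons_poly_def -!mul_polyC !(polyCD, polyCN, polyCM, polyC0).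
rewrite !polyC1; ring.
Qed.

Lemma polyseq_quartic t :
  quartic t = [:: 1; 4 * t; 6 * t + 2; - (4 * t); 1] :> seq algC.
Proof. by rewrite quarticE (PolyK (c := 0)) //= oner_neq0. Qed.

Lemma horner_quartic t x : (quartic t).[x] =
  x ^+ 4 - 4 * t * x ^+ 3 + (6 * t + 2) * x ^+ 2 + 4 * t * x + 1.
Proof.
by rewrite /quartic !(hornerD, hornerN, hornerZ, hornerXn, hornerX, hornerC).
Qed.

Lemma horner_quartic_deriv t x : (quartic t)^`().[x] =
  4 * x ^+ 3 - 12 * t * x ^+ 2 + 2 * (6 * t + 2) * x + 4 * t.
Proof.
rewrite /quartic !(derivD, derivN, derivZ, derivXn, derivX, derivC) /=.
rewrite !(hornerD, hornerN, hornerZ, hornerMn, hornerXn, hornerX, hornerC).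
ring.
Qed.

(** f is invariant, up to the factor x^4, under x |-> -1/x: with z = x - 1/x,
    f(x) / x^2 = z^2 - 4tz + 6t + 4, whose roots are z = 2t + s with
    s^2 = D = 4t^2 - 6t - 4.  As D is not a square, 1 and s are independent
    over M.  A nontrivial relation among 1, xi, xi^2, xi^3 would put xi in
    M(s), and then the discriminant z^2 + 4 = 8t^2 - 6t + 4ts of
    x^2 - zx - 1 would be a square (g + hs)^2 there.  Its norm to M is (10t)^2,
    so g^2 - h^2 D = 10t or -10t, and together with g^2 + h^2 D = 8t^2 - 6t
    this makes g^2 one of the two other excluded values. *)
Lemma quartic_basis (M : divringClosed algC) t xi :
  t \in M -> root (quartic t) xi ->
  (forall g, g \in M -> g ^+ 2 <> 4 * t ^+ 2 - 6 * t - 4) ->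
  (forall g, g \in M -> g ^+ 2 <> 4 * t ^+ 2 + 2 * t) ->
  (forall g, g \in M -> g ^+ 2 <> 4 * t ^+ 2 - 8 * t) ->
  forall q0 q1 q2 q3, q0 \in M -> q1 \in M -> q2 \in M -> q3 \in M ->
    q0 + q1 * xi + q2 * xi ^+ 2 + q3 * xi ^+ 3 = 0 ->
  [/\ q0 = 0, q1 = 0, q2 = 0 & q3 = 0].
Proof.
move=> tM; rewrite /root horner_quartic => /eqP fxi nsqD nsq1 nsq2.
move=> q0 q1 q2 q3 q0M q1M q2M q3M Eq.
have xi0 : xi != 0.
  apply/eqP => xi0; move: fxi; rewrite xi0 !expr0n /= !mulr0 subr0 !add0r.
  by apply/eqP; rewrite oner_neq0.
pose D := 4 * t ^+ 2 - 6 * t - 4.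
pose s := xi - xi^-1 - 2 * t.
have nM k : k%:R \in M by rewrite rpred_nat.
have DM : D \in M by rewrite /D !(rpred_nat, rpredB, rpredM, rpredX).
have sD : s ^+ 2 = D.
  apply/eqP; rewrite -subr_eq0; apply/eqP.
  by rewrite -[RHS](mul0r (xi ^- 2)) -fxi /s /D; field.
have xi2 : xi ^+ 2 = (s + 2 * t) * xi + 1 by rewrite /s; field.
have indep a b : a \in M -> b \in M -> a + b * s = 0 -> a = 0 /\ b = 0.
  move=> aM bM E; have [b0|b0] := eqVneq b 0.
    by move: E; rewrite b0 mul0r addr0.
  case: (nsqD (- a / b)); first by rewrite rpred_div ?rpredN.
  rewrite -[RHS]sD; congr (_ ^+ 2).
  by apply: (mulfI b0); apply/eqP; rewrite -subr_eq0 -oppr_eq0 -E; apply/eqP; field.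
pose a0 := q0 + q2 + 2 * t * q3; pose a1 := q3.
pose b0 := q1 + 2 * t * q2 + q3 * (8 * t ^+ 2 - 6 * t - 3).
pose b1 := q2 + 4 * t * q3.
have a0M : a0 \in M by rewrite /a0 !(rpred_nat, rpredD, rpredM).
have b0M : b0 \in M by rewrite /b0 !(rpred_nat, rpredB, rpredD, rpredM, rpredX).
have b1M : b1 \in M by rewrite /b1 !(rpred_nat, rpredD, rpredM).
(* The relation, rewritten in the basis 1, xi over M(s). *)
have Eab : (a0 + a1 * s) + (b0 + b1 * s) * xi = 0.
  rewrite -Eq.
  have -> : xi ^+ 3 = xi * xi ^+ 2 by ring.
  have -> : xi * xi ^+ 2 = (s + 2 * t) * xi ^+ 2 + xi by rewrite {1}xi2; ring.
  rewrite xi2 /a0 /a1 /b0 /b1.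
  have sD' : s ^+ 2 = 4 * t ^+ 2 - 6 * t - 4 := sD.
  ring: sD'.
have [B0|Bn0] := eqVneq (b0 + b1 * s) 0.
  have [b00 b10] := indep _ _ b0M b1M B0.
  have [|a00 a10] := indep a0 a1 a0M q3M; first by rewrite -Eab B0; ring.
  have q30 : q3 = 0 by [].
  have q20 : q2 = 0 by rewrite -b10 /b1 q30; ring.
  have q10 : q1 = 0 by rewrite -b00 /b0 q30 q20; ring.
  by split=> //; rewrite -a00 /a0 q30 q20; ring.
exfalso.
(* Dividing by b0 + b1 s through its norm N puts xi in M(s). *)
pose N := b0 ^+ 2 - b1 ^+ 2 * D.
have EN : N = (b0 + b1 * s) * (b0 + - b1 * s) by rewrite /N -sD; ring.
have N0 : N != 0.
  rewrite EN mulf_neq0 //; apply/eqP => E.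
  have [b00 /eqP] := indep b0 (- b1) b0M (rpredNr b1M) E.
  by rewrite oppr_eq0 => /eqP b10; rewrite b00 b10 mul0r addr0 eqxx in Bn0.
have NM : N \in M by rewrite /N !(rpredB, rpredM, rpredX).
pose x0 := - (a0 * b0 - a1 * b1 * D) / N.
pose x1 := - (a1 * b0 - a0 * b1) / N.
have Exi : xi = x0 + x1 * s.
  apply: (mulfI Bn0); apply: (mulfI N0).
  have -> : (b0 + b1 * s) * xi = - (a0 + a1 * s).
    by apply/eqP; rewrite -subr_eq0 -Eab; apply/eqP; ring.
  rewrite /x0 /x1 mulrCA.
  have -> : N * (- (a0 * b0 - a1 * b1 * D) / N + - (a1 * b0 - a0 * b1) / N * s) =
     - ((a0 * b0 - a1 * b1 * D) + (a1 * b0 - a0 * b1) * s) by field.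
  by rewrite /N -sD; ring.
have x0M : x0 \in M by rewrite /x0 !(rpred_div, rpredN, rpredB, rpredM).
have x1M : x1 \in M by rewrite /x1 !(rpred_div, rpredN, rpredB, rpredM).
clearbody x0 x1.
pose g := 2 * x0 - 2 * t; pose h := 2 * x1 - 1.
have gM : g \in M by rewrite /g !(rpred_nat, rpredB, rpredM).
have hM : h \in M by rewrite /h !(rpred_nat, rpredB, rpredM, rpred1).
have Egh : (g + h * s) ^+ 2 = 4 * t * s + 8 * t ^+ 2 - 6 * t.
  have -> : g + h * s = 2 * xi - (s + 2 * t) by rewrite Exi /g /h; ring.
  have -> : (2 * xi - (s + 2 * t)) ^+ 2 = 
    4 * (xi ^+ 2 - (s + 2 * t) * xi) + s ^+ 2 + 4 * t * s + 4 * t ^+ 2 by ring.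
  by rewrite xi2 sD /D; ring.
clearbody g h.
have [|||g1 g2] := indep (g ^+ 2 + h ^+ 2 * D - 8 * t ^+ 2 + 6 * t) (2 * g * h - 4 * t).
- by rewrite !(rpred_nat, rpredB, rpredM, rpredX, rpredD).
- by rewrite !(rpred_nat, rpredB, rpredM).
- have -> : g ^+ 2 + h ^+ 2 * D - 8 * t ^+ 2 + 6 * t + (2 * g * h - 4 * t) * s
    = (g + h * s) ^+ 2 - (4 * t * s + 8 * t ^+ 2 - 6 * t) by rewrite -sD; ring.
  by rewrite Egh subrr.
have g1' : h ^+ 2 * D = 8 * t ^+ 2 - 6 * t - g ^+ 2.
  by apply/eqP; rewrite -subr_eq0 -g1; apply/eqP; ring.
have g2' : 2 * g * h = 4 * t by apply/eqP; rewrite -subr_eq0 g2.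
have : (g ^+ 2 - h ^+ 2 * D) ^+ 2 = (10 * t) ^+ 2.
  have -> : (g ^+ 2 - h ^+ 2 * D) ^+ 2 =
    (g ^+ 2 + h ^+ 2 * D) ^+ 2 - (2 * g * h) ^+ 2 * D by ring.
  by rewrite g1' g2' /D; ring.
move/eqP; rewrite eqf_sqr g1' => /orP[] /eqP E.
  apply: (nsq1 g gM); apply: (mulfI (x := 2)); rewrite ?pnatr_eq0 //.
  have -> : 2 * g ^+ 2 = (g ^+ 2 - (8 * t ^+ 2 - 6 * t - g ^+ 2)) + 8 * t ^+ 2 - 6 * t by ring.
  by rewrite E; ring.
apply: (nsq2 g gM); apply: (mulfI (x := 2)); rewrite ?pnatr_eq0 //.
have -> : 2 * g ^+ 2 = (g ^+ 2 - (8 * t ^+ 2 - 6 * t - g ^+ 2)) + 8 * t ^+ 2 - 6 * t by ring.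
by rewrite E; ring.
Qed.

(** * Imaginary quadratic fields and their rings of integers *)

Lemma ring_adjoinP (A : addrClosed algC) x z :
  ring_adjoin [set` A]%classic x z <-> exists2 p, p \is a polyOver A & z = p.[x].
Proof.
split=> [[p pA ->]|[p /polyOverP pA ->]]; exists p => //.
by apply/polyOverP.
Qed.

Lemma rat_adjoin_divring_closed x : divring_closed (mem (rat_adjoin x)).
Proof.
have adjP := ring_adjoinP Crat x.
split=> [|y z|y z]; rewrite !in_setE.
- by exists 1, 1; rewrite divr1; split=> //; apply/adjP;
    exists 1; rewrite ?hornerE ?rpred1.
- move=> [u [v [/adjP[p pQ ->] /adjP[q qQ ->] ->]]].
  move=> [u' [v' [/adjP[p' pQ' ->] /adjP[q' qQ' ->] ->]]].
  have [q0|q0] := eqVneq q.[x] 0.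
    exists (- p'.[x]), q'.[x]; rewrite q0 invr0 mulr0 sub0r mulNr; split=> //; apply/adjP.
      by exists (- p'); rewrite ?hornerN ?rpredN.
    by exists q'.
  have [q0'|q0'] := eqVneq q'.[x] 0.
    exists p.[x], q.[x]; rewrite q0' invr0 mulr0 subr0; split=> //; apply/adjP.
      by exists p.
    by exists q.
  exists (p * q' - p' * q).[x], (q * q').[x]; split.
  + by apply/adjP; exists (p * q' - p' * q); rewrite // rpredB ?rpredM.
  + by apply/adjP; exists (q * q'); rewrite // rpredM.
  + by rewrite hornerD hornerN !hornerM; field; rewrite q0 q0'.
- move=> [u [v [/adjP[p pQ ->] /adjP[q qQ ->] ->]]].
  move=> [u' [v' [/adjP[p' pQ' ->] /adjP[q' qQ' ->] ->]]].
  exists (p * q').[x], (q * p').[x]; split.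
  + by apply/adjP; exists (p * q'); rewrite // rpredM.
  + by apply/adjP; exists (q * p'); rewrite // rpredM.
  + by rewrite !hornerM invf_div invfM mulrACA.
Qed.

(** The field and its ring of integers as predicates, to carry closure
    properties. *)
Definition imquad_field (d : int) : {pred algC} := mem (imquad d).

HB.instance Definition _ (d : int) :=
  GRing.isDivringClosed.Build algC (imquad_field d) (rat_adjoin_divring_closed _).

Definition imquad_order (d : int) : {pred algC} :=
  mem (ring_of_integers (imquad d)).

Lemma imquad_orderE d z :
  (z \in imquad_order d) = (z \in imquad_field d) && (z \in Aint).
Proof.
apply/idP/andP; rewrite /imquad_order /imquad_field !in_setE.
  by case.
by case=> ? ?; split.
Qed.

Lemma imquad_order_subring_closed d : subring_closed (imquad_order d).
Proof.
split=> [|x y|x y]; rewrite !imquad_orderE ?rpred1 //.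
  by move=> /andP[xM xA] /andP[yM yA]; rewrite !rpredB.
by move=> /andP[xM xA] /andP[yM yA]; rewrite !rpredM.
Qed.

HB.instance Definition _ (d : int) :=
  GRing.isSubringClosed.Build algC (imquad_order d) (imquad_order_subring_closed d).

Lemma order_adjoinP d x z :
  ring_adjoin (ring_of_integers (imquad d)) x z <->
  exists2 p, p \is a polyOver (imquad_order d) & z = p.[x].
Proof.
split=> [[p pA ->]|[p /polyOverP pA ->]]; exists p => //.
  by apply/polyOverP => i; rewrite /imquad_order in_setE.
by move=> i; have := pA i; rewrite /imquad_order in_setE.
Qed.

Definition imquad_gen (d : int) : algC := 'i * sqrtC d%:~R.

Lemma imquad_gen_sqr d : imquad_gen d ^+ 2 = - d%:~R.
Proof. by rewrite exprMn sqrCi sqrtCK mulN1r. Qed.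

Lemma imquad_gen_conj d : 0 < d -> (imquad_gen d)^* = - imquad_gen d.
Proof.
move=> d0; rewrite rmorphM /= conjCi mulNr conj_Creal //.
by rewrite ger0_real // sqrtC_ge0 ler0z ltW.
Qed.

Lemma imquad_gen_order d : imquad_gen d \in imquad_order d.
Proof.
rewrite imquad_orderE; apply/andP; split.
  rewrite /imquad_field in_setE; exists (imquad_gen d), 1.
  rewrite divr1; split=> //; apply/ring_adjoinP.
    by exists 'X; rewrite ?hornerX ?polyOverX.
  by exists 1; rewrite ?hornerE ?rpred1.
apply: (root_monic_Aint (p := 'X^2 + d%:~R%:P)).
- by rewrite /root hornerD hornerXn hornerC imquad_gen_sqr addNr.
- by rewrite monicE lead_coefDl ?lead_coefXn // size_polyXn size_polyC; case: eqP.
- apply/polyOverP => i; rewrite coefD coefXn coefC rpredD ?rpred_nat //.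
  by case: ifP => _; rewrite ?rpred_int ?rpred0.
Qed.

Lemma imquad_coords d z : 0 < d -> z \in imquad_field d ->
  exists a b, [/\ a \in Crat, b \in Crat & z = a + b * imquad_gen d].
Proof.
move=> d0; rewrite /imquad_field in_setE /imquad.
rewrite -/(imquad_gen d); set w := imquad_gen d.
have wd : d%:~R = - w ^+ 2 by rewrite imquad_gen_sqr opprK.
have coords y : ring_adjoin [set` Crat]%classic w y ->
  exists a b, [/\ a \in Crat, b \in Crat & y = a + b * w].
  move=> /ring_adjoinP[p pQ ->]; elim/(polyOver_ind (R := Crat)): p / pQ.
    by exists 0, 0; rewrite horner0 mul0r addr0 rpred0.
  move=> p c pQ cQ [a [b [aQ bQ E]]]; exists (c - d%:~R * b), a; split=> //.
    by rewrite rpredB ?rpredM ?rpred_int.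
  by rewrite hornerMXaddC E wd; ring.
move=> [u [v [/coords[a [b [aQ bQ ->]]] /coords[a' [b' [aQ' bQ' ->]]] ->]]].
have [E|v0] := eqVneq (a' + b' * w) 0.
  by exists 0, 0; rewrite E invr0 mulr0 mul0r addr0 rpred0.
pose N := a' ^+ 2 + d%:~R * b' ^+ 2.
have EN : N = (a' + b' * w) * (a' + b' * w)^*.
  have cw : w^* = - w := imquad_gen_conj d0.
  rewrite rmorphD rmorphM /= cw !conj_Crat //.
  have -> : (a' + b' * w) * (a' + b' * - w) = a' ^+ 2 - w ^+ 2 * b' ^+ 2 by ring.
  by rewrite imquad_gen_sqr /N; ring.
have N0 : N != 0 by rewrite EN mulf_neq0 ?conjC_eq0.
have NQ : N \in Crat by rewrite /N rpredD ?rpredM ?rpredX ?rpred_int.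
exists ((a * a' + d%:~R * b * b') / N), ((b * a' - a * b') / N); split.
- by rewrite rpred_div ?rpredD ?rpredM ?rpred_int.
- by rewrite rpred_div ?rpredB ?rpredM.
rewrite /N wd; field; rewrite v0 andbT.
by move: N0; rewrite /N wd.
Qed.

Lemma imquad_normE d a b : 0 < d -> a \in Crat -> b \in Crat ->
  `|a + b * imquad_gen d| ^+ 2 = a ^+ 2 + d%:~R * b ^+ 2.
Proof.
move=> d0 aQ bQ; rewrite normCK rmorphD rmorphM /= (conj_Crat aQ) (conj_Crat bQ) imquad_gen_conj //.
set w := imquad_gen d.
have -> : (a + b * w) * (a + b * - w) = a ^+ 2 - w ^+ 2 * b ^+ 2 by ring.
by rewrite imquad_gen_sqr; ring.
Qed.

Lemma imquad_norm_int d z : 0 < d -> z \in imquad_order d -> `|z| ^+ 2 \in Num.int.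
Proof.
move=> d0; rewrite imquad_orderE => /andP[/(imquad_coords d0)[a [b [aQ bQ ->]]] zA].
apply: Cint_rat_Aint.
  by rewrite imquad_normE // rpredD ?rpredM ?rpredX ?rpred_int.
by rewrite normCK rpredM // Aint_aut.
Qed.

(** The squared absolute value is the norm, a positive rational integer. *)
Lemma imquad_order_norm_ge1 d z :
  0 < d -> z \in imquad_order d -> z != 0 -> 1 <= `|z|.
Proof.
move=> d0 zR z0; have nZ := imquad_norm_int d0 zR.
have := norm_intr_ge1 nZ; rewrite expf_eq0 normr_eq0 (negPf z0) => /(_ isT).
by rewrite normrX normr_id -{1}(expr1n _ 2) ler_pXn2r // nnegrE.
Qed.

(** n is the product of u - v and u + v, both of absolute value at least 1 and
    hence at most |n|; and 2u is their sum. *)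
Lemma norm_le_of_sqr_diff (R : subringClosed algC) (u v n : algC) :
  (forall z, z \in R -> z != 0 -> 1 <= `|z|) ->
  u \in R -> v \in R -> n != 0 -> u ^+ 2 - v ^+ 2 = n -> `|u| <= `|n|.
Proof.
move=> R1 uR vR n0 E.
have En : n = (u - v) * (u + v) by rewrite -E; ring.
have : (u - v) * (u + v) != 0 by rewrite -En.
rewrite mulf_eq0 negb_or => /andP[/(R1 _ (rpredB uR vR)) h1 /(R1 _ (rpredD uR vR)) h2].
have l1 : `|u - v| <= `|n| by rewrite En normrM ler_peMr.
have l2 : `|u + v| <= `|n| by rewrite En normrM ler_peMl.
have l3 : `|2 * u| <= `|u - v| + `|u + v|.
  by have -> : 2 * u = (u - v) + (u + v) by [ring]; apply: ler_normD.
rewrite normrM normr_nat in l3.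
have : 2 * `|u| <= 2 * `|n| by rewrite [2 * `|n|]mulr_natl mulr2n (le_trans l3) ?lerD.
by rewrite ler_pM2l ?ltr0n.
Qed.

(** * Ramification at 2 *)

(** If q were even, p would be odd and p^2 = 1 mod 4 would force 4 to divide
    d.  So q^2 = 1 mod 4 and d p^2 + A^2 = 0 mod 4, which for d = 1, 2 mod 4
    leaves only even p and A. *)
Lemma half_integral_parity (d p q A N : int) :
  (exists k, d = 1 + 4 * k \/ d = 2 + 4 * k) ->
  coprime `|p| `|q| -> d * p ^+ 2 = (4 * N - A ^+ 2) * q ^+ 2 ->
  exists p' q' A', [/\ p = 2 * p', q = 2 * q' + 1 & A = 2 * A'].
Proof.
move=> [k dk] cop E.
have [p' [Ep|Ep]] := int_parity p; have [q' [Eq|Eq]] := int_parity q;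
have [A' [EA|EA]] := int_parity A.
all: try by exists p', q', A'.
all: exfalso.
all: try by move: cop; rewrite Ep Eq !abszM /coprime -muln_gcdr; case: gcdn => [|[]].
all: move: E; rewrite Ep Eq EA; clear -dk; case: dk => ->; rewrite !expr2; lia.
Qed.

(** As d need not be squarefree, the ring of integers can be larger than
    Z[i sqrt d], but only by odd denominators: for x = a + bw the trace
    A = 2a and the norm N = a^2 + d b^2 are integers, and half_integral_parity
    applies to A, N and the reduced fraction p/q = 2b. *)
Lemma imquad_order_odd_multiple d x : 0 < d ->
  (exists k, d = 1 + 4 * k \/ d = 2 + 4 * k) -> x \in imquad_order d ->
  exists j m n : int, (2 * j + 1)%:~R * x = m%:~R + n%:~R * imquad_gen d.
Proof.
move=> d0 dk xR; have /intrP[N EN] := imquad_norm_int d0 xR.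
move: (xR); rewrite imquad_orderE => /andP[/(imquad_coords d0)[a [b [aQ bQ Ex]]] xA].
set w := imquad_gen d in Ex *.
have /intrP[A EA] : 2 * a \in Num.int.
  apply: Cint_rat_Aint; first by rewrite rpredM ?rpred_nat.
  have -> : 2 * a = x + x^*.
    have cw : w^* = - w := imquad_gen_conj d0.
    by rewrite Ex rmorphD rmorphM /= (conj_Crat aQ) (conj_Crat bQ) cw; ring.
  by rewrite rpredD // Aint_aut.
have /CratP[beta Eb] : 2 * b \in Crat by rewrite rpredM ?rpred_nat.
pose p := numq beta; pose q := denq beta.
have q0 : q%:~R != 0 :> algC by rewrite intr_eq0 denq_neq0.
have Ebq : 2 * b * q%:~R = p%:~R.
  by rewrite Eb /ratr divfK.
have Eint : d * p ^+ 2 = (4 * N - A ^+ 2) * q ^+ 2.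
  apply: (intr_inj (R := algC)).
  rewrite !(rmorphM, rmorphB, rmorphXn) /= -Ebq -EA -EN Ex imquad_normE //.
  ring.
have [p' [q' [A' [Ep Eq EA']]]] := half_integral_parity dk (coprime_num_den beta) Eint.
rewrite -/p -/q in Ep Eq.
exists q', (q * A'), p'; rewrite -Eq Ex.
apply: (mulfI (x := 2)); first by rewrite pnatr_eq0.
have -> : 2 * (q%:~R * (a + b * w)) = q%:~R * (2 * a) + 2 * b * q%:~R * w by ring.
by rewrite EA Ebq Ep EA' !rmorphM /=; ring.
Qed.

(** Otherwise w = a + 2x would give (a^2 + d) / 4 = - (ax + x^2), a rational
    algebraic integer, while a^2 + d is not divisible by 4. *)
Lemma imquad_no_half_integer (d a : int) (x : algC) :
  (exists k, d = 1 + 4 * k \/ d = 2 + 4 * k) ->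
  x \in Aint -> imquad_gen d <> a%:~R + 2 * x.
Proof.
move=> [k dk] xA E.
have Ex : a%:~R * x + x ^+ 2 = - (a ^+ 2 + d)%:~R / 4.
  have := imquad_gen_sqr d; rewrite E rmorphD rmorphXn /= => E2.
  have -> : d%:~R = - (a%:~R + 2 * x) ^+ 2 :> algC by rewrite E2 opprK.
  by field.
have /intrP[n En] : (- (a ^+ 2 + d)%:~R / 4 : algC) \in Num.int.
  apply: Cint_rat_Aint; first by rewrite rpred_div ?rpredN ?rpred_int ?rpred_nat.
  by rewrite -Ex rpredD ?rpredM ?rpredX ?rpred_int.
have Ei : - (a ^+ 2 + d) = n * 4.
  by apply: (intr_inj (R := algC)); rewrite rmorphN rmorphM /= -En; field.
have [a' [Ea|Ea]] := int_parity a; move: Ei; rewrite Ea !expr2; clear -dk;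
  case: dk => ->; lia.
Qed.

Lemma Aint_half_neq (x : algC) : x \in Aint -> 1 <> 2 * x.
Proof.
move=> xA E; have Ex : x = 2^-1 by apply: (mulfI (x := 2)); rewrite -?E ?divff ?pnatr_eq0.
have /intrP[n En] : x \in Num.int.
  by apply: Cint_rat_Aint => //; rewrite Ex rpredV rpred_nat.
have : 1 = 2 * n :> int.
  by apply: (intr_inj (R := algC)); rewrite rmorphM /= -En; exact: E.
by clear; lia.
Qed.

(** eps is w or w + 1 according as d is 2 or 1 modulo 4: then (2, eps) is the
    prime above 2, its square lies in 2R and its residue field is F_2. *)
Lemma imquad_order_ramified d : 0 < d ->
  (exists k, d = 1 + 4 * k \/ d = 2 + 4 * k) ->
  exists eps, let R := imquad_order d in
    [/\ eps \in R,
        exists2 w, w \in R & eps ^+ 2 = 2 * w,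
        forall x, x \in R ->
          exists2 a, a \in Num.int & prime_over2 R eps (x - a),
        forall a w, a \in Num.int -> w \in R -> eps <> a + 2 * w
      & ~ prime_over2 R eps 1].
Proof.
move=> d0 dk.
set w := imquad_gen d; have wR : w \in imquad_order d := imquad_gen_order d.
have [delta [w2 w2R Ew2]] : exists delta : int,
    exists2 w2, w2 \in imquad_order d & (w + delta%:~R) ^+ 2 = 2 * w2.
  have sqr (e : algC) : (w + e) ^+ 2 = e ^+ 2 - d%:~R + 2 * e * w.
    by rewrite -(opprK d%:~R) -imquad_gen_sqr -/w; ring.
  have [k [Ed|Ed]] := dk.
    exists 1, (- (2 * k)%:~R + w); first by rewrite rpredD ?rpredN ?rpred_int.
    by rewrite sqr Ed rmorphD !rmorphM /=; ring.
  exists 0, (- (1 + 2 * k)%:~R); first by rewrite rpredN ?rpred_int.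
  by rewrite sqr mulr0z Ed !rmorphD !rmorphM /=; ring.
pose eps := w + delta%:~R.
have eps2 : exists2 w2, w2 \in imquad_order d & eps ^+ 2 = 2 * w2 by exists w2.
have eR : eps \in imquad_order d by rewrite /eps rpredD ?rpred_int.
have Aint_order x : x \in imquad_order d -> x \in Aint.
  by rewrite imquad_orderE => /andP[].
exists eps; split=> //.
- move=> x xR; have [j [m [n E]]] := imquad_order_odd_multiple d0 dk xR.
  exists (m - n * delta)%:~R; first exact: intr_int.
  exists (- j%:~R * x), n%:~R; split; rewrite ?rpredM ?rpredN ?rpred_int //.
  have Ex : x = m%:~R + n%:~R * w - 2 * (j%:~R * x).
    by rewrite -E rmorphD rmorphM /=; ring.
  by rewrite {1}Ex /eps rmorphB rmorphM /=; ring.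
- move=> a u /intrP[m ->] uR E.
  apply: (imquad_no_half_integer (a := m - delta) dk (Aint_order _ uR)).
  by rewrite rmorphB /= -/w addrAC -E /eps addrK.
- move=> /(prime_over2_sqr eR eps2)[h hR]; rewrite expr1n.
  exact: Aint_half_neq (Aint_order _ hR).
Qed.

(** * The kernel of evaluation at a root of the quartic *)

Lemma Aint_of_sqr (x : algC) : x ^+ 2 \in Aint -> x \in Aint.
Proof.
rewrite {1}/Aint unfold_in => pZ; pose p := minCpoly (x ^+ 2).
apply: (root_monic_Aint (p := p \Po 'X^2)).
- by rewrite /root horner_comp hornerXn; apply: root_minCpoly.
- rewrite monicE lead_coef_comp ?size_polyXn // lead_coefXn expr1n mulr1.
  by rewrite -monicE minCpoly_monic.
- apply/polyOverP => i; rewrite coef_comp_poly_Xn //.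
  by case: ifP => _; rewrite ?rpred0 //; apply/polyOverP.
Qed.

(** v is integral because v^2 = u^2 - n is. *)
Lemma imquad_sqr_diff_bound d (u v : algC) (n : nat) : 0 < d ->
  u \in imquad_order d -> v \in imquad_field d -> (0 < n)%N ->
  u ^+ 2 - v ^+ 2 = n%:R -> `|u| <= n%:R.
Proof.
move=> d0 uR vM n0 E.
have vR : v \in imquad_order d.
  rewrite imquad_orderE vM; apply: Aint_of_sqr.
  have -> : v ^+ 2 = u ^+ 2 - n%:R by rewrite -E; ring.
  by move: uR; rewrite imquad_orderE => /andP[_ uA]; rewrite rpredB ?rpredX ?rpred_nat.
rewrite -(normr_nat algC n); apply: norm_le_of_sqr_diff uR vR _ E.
  by move=> z; apply: imquad_order_norm_ge1.
by rewrite pnatr_eq0 -lt0n.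
Qed.

(** The remainder of P modulo f is a relation of degree less than 4, killed by
    quartic_basis.  Its three hypotheses follow from the identities
    (4t - 3)^2 - 4(4t^2 - 6t - 4) = 25, (4t + 1)^2 - 4(4t^2 + 2t) = 1 and
    (2t - 2)^2 - (4t^2 - 8t) = 4: a square would give |4t| <= 28, |4t| <= 2 or
    |2t| <= 6. *)
Lemma order_kernel_quartic d t xi P : 0 < d ->
  t \in imquad_order d -> 30 < `|t| -> root (quartic t) xi ->
  P \is a polyOver (imquad_order d) -> P.[xi] = 0 ->
  exists2 q, q \is a polyOver (imquad_order d) & P = quartic t * q.
Proof.
move=> d0 tR t_big rt PR Pxi.
have inM x : x \in imquad_order d -> x \in imquad_field d.
  by rewrite imquad_orderE => /andP[].
have too_big (m l n : nat) (u : algC) : (1 < m)%N -> (l + n <= 30)%N ->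
    `|m%:R * t| <= `|u| + l%:R -> `|u| <= n%:R -> False.
  move=> m1 ln um un.
  have : `|m%:R * t| <= 30.
    by rewrite (le_trans um) // (le_trans (lerD un (lexx _))) // -natrD ler_nat addnC.
  rewrite normrM normr_nat => mt.
  have : 1 * `|t| <= 30 by rewrite (le_trans _ mt) // ler_wpM2r // ler1n ltnW.
  by rewrite mul1r => /(lt_le_trans t_big); rewrite ltxx.
have sz : size (quartic t) = 5 by rewrite polyseq_quartic.
have fm : quartic t \is monic by rewrite monicE lead_coefE sz polyseq_quartic.
have fR : quartic t \is a polyOver (imquad_order d).
  apply/polyOverP => i; rewrite polyseq_quartic.
  by case: i => [|[|[|[|[|i]]]]] /=;
    rewrite ?nth_nil ?(rpred0, rpred1, rpred_nat, rpredN, rpredM, rpredD).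
have [|q [r [qR rR sr EP]]] := division_over fm fR _ PR; first by rewrite sz.
have sr4 : (size r <= 4)%N by rewrite sz in sr.
suff r0 : r = 0 by exists q; rewrite // EP r0 addr0.
have rM i : r`_i \in imquad_field d by apply: inM; apply/polyOverP.
have [||||r0 r1 r2 r3] := quartic_basis (inM _ tR) rt _ _ _ (rM 0) (rM 1) (rM 2) (rM 3).
- move=> g gM E; apply: (too_big 4 3 25 (4 * t - 3)) => //.
    by rewrite -[X in `|X| <= _](subrK 3) (le_trans (ler_normD _ _)) ?normr_nat.
  apply: (imquad_sqr_diff_bound (v := 2 * g) d0) => //.
  + by rewrite rpredB ?rpredM ?rpred_nat.
  + by rewrite rpredM ?rpred_nat.
  + by rewrite exprMn E; ring.
- move=> g gM E; apply: (too_big 4 1 1 (4 * t + 1)) => //.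
    by rewrite -[X in `|X| <= _](addrK 1) (le_trans (ler_normB _ _)) ?normr1.
  apply: (imquad_sqr_diff_bound (v := 2 * g) d0) => //.
  + by rewrite rpredD ?rpredM ?rpred_nat ?rpred1.
  + by rewrite rpredM ?rpred_nat.
  + by rewrite exprMn E; ring.
- move=> g gM E; apply: (too_big 2 2 4 (2 * t - 2)) => //.
    by rewrite -[X in `|X| <= _](subrK 2) (le_trans (ler_normD _ _)) ?normr_nat.
  apply: (imquad_sqr_diff_bound (v := g) d0) => //.
  + by rewrite rpredB ?rpredM ?rpred_nat.
  + by rewrite E; ring.
- have : r.[xi] = 0.
    by move: Pxi; rewrite EP hornerD hornerM (rootP rt) mul0r add0r.
  rewrite (horner_coef_wide _ sr4) !big_ord_recl big_ord0 /=.
  by rewrite expr0 mulr1 addr0 !addrA.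
apply/polyP => i; rewrite coef0.
case: i => [|[|[|[|i]]]] //; apply: nth_default.
exact: leq_trans sr4 _.
Qed.

Theorem theorem8 (d : int) (t xi : algC) :
  0 < d ->
  (- d = 2 %[mod 4])%Z \/ (- d = 3 %[mod 4])%Z ->
  ring_of_integers (imquad d) t ->
  root (quartic t) xi ->
  1544 * 1000 + 803 < `|t| ->
  ~ has_power_integral_basis (ring_adjoin (ring_of_integers (imquad d)) xi).
Proof.
move=> d0 d_mod4 tR0 rt t_big [alpha /order_adjoinP[A AR Ealpha] EO].
have tR : t \in imquad_order d by rewrite /imquad_order in_setE.
have t30 : 30 < `|t| by apply: le_lt_trans t_big; rewrite -natrM -natrD ler_nat.
have dk : exists k, d = 1 + 4 * k \/ d = 2 + 4 * k.
  by exists (d %/ 4)%Z; clear -d_mod4; lia.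
have [eps [eR eps2 residue eps_not_int not1]] := imquad_order_ramified d0 dk.
have in_O y : y \in imquad_order d -> exists2 p, p \is a polyOver Num.int & y = p.[alpha].
  move=> yR; apply/ring_adjoinP; rewrite -EO; apply/order_adjoinP.
  by exists y%:P; rewrite ?hornerC ?polyOverC.
have [p pZ Ep] := in_O eps eR.
have [r rZ Er] : exists2 r, r \is a polyOver Num.int & xi = r.[alpha].
  apply/ring_adjoinP; rewrite -EO; apply/order_adjoinP.
  by exists 'X; rewrite ?hornerX ?polyOverX.
rewrite Ealpha in Ep Er.
apply: (@not_monogenic_of_cotangent (imquad_order d) eps xi (-1)) AR pZ rZ Ep Er => //.
- by rewrite rpredN rpred1.
- move=> P PR /(order_kernel_quartic d0 tR t30 rt PR)[q qR ->].
  have qc : q.[-1] \in imquad_order d by rewrite rpred_horner ?rpredN ?rpred1.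
  have dqc : q^`().[-1] \in imquad_order d.
    by rewrite rpred_horner ?polyOver_deriv ?rpredN ?rpred1.
  (* Both are even since f = (X + 1)^4 mod 2. *)
  have f1 : (quartic t).[-1] = 2 * (2 + 3 * t) by rewrite horner_quartic; ring.
  have f1' : (quartic t)^`().[-1] = 2 * (- 4 - 10 * t).
    by rewrite horner_quartic_deriv; ring.
  split.
    exists ((2 + 3 * t) * q.[-1]); first by rewrite !(rpred_nat, rpredM, rpredD).
    by rewrite hornerM f1; ring.
  exists ((- 4 - 10 * t) * q.[-1] + (2 + 3 * t) * q^`().[-1]), 0; split.
  + by rewrite !(rpred_nat, rpredN, rpredM, rpredD).
  + by rewrite rpred0.
  + by rewrite derivM hornerD !hornerM f1 f1'; ring.
Qed.
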